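(* Let $\psi_{j,\infty}$, for $j=1,\dots,N$, with $\|\psi_{j,\infty}\|_2=1$, solve the stationary equations $$0=\Omega_j\psi_{j,\infty}+\frac{i\kappa}{2}\big(\zeta_\infty-\langle\zeta_\infty,\psi_{j,\infty}\rangle\psi_{j,\infty}\big),\quad j=1,\dots,N,\qquad \zeta_\infty=\frac1N\sum_{l=1}^N\psi_{l,\infty}.$$ Then for $\alpha_j\in[-\pi,\pi)$ determined by the parameters $\kappa,\Omega_j$, the following relations characterize a class of fixed points of the correlation system $$\frac{d}{dt}z_{jk}=i(\Omega_j-\Omega_k)z_{jk}+\frac{\kappa}{2N}\sum_{l=1}^N(z_{jl}+z_{lk})(1-z_{jk}),\quad j,k=1,\dots,N:$$ $$\psi_{j,\infty}=\frac{\zeta_\infty}{\lambda_\infty}e^{-i\alpha_j},\quad r_{jk}^\infty=\cos(\alpha_j-\alpha_k),\quad s_{jk}^\infty=\sin(\alpha_j-\alpha_k),\quad z_{jk}^\infty=e^{i(\alpha_j-\alpha_k)},$$ $$r_j^\infty=\lambda_\infty\cos(\alpha_j),\quad s_j^\infty=-\lambda_\infty\sin(\alpha_j)=-\frac{\Omega_j}{\kappa},\quad z_j^\infty=\lambda_\infty e^{-i\alpha_j},$$ $$\lambda_\infty=\frac1N\sum_{j=1}^N\cos(\alpha_j),\qquad 0=\frac1N\sum_{j=1}^N\sin(\alpha_j).$$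
   Context: $\kappa>0$ is the coupling strength and $\Omega_j\in\mathbb{R}$, $j=1,\dots,N$, are natural frequencies with $\frac1N\sum_{j=1}^N\Omega_j=0$. All norms and inner products are those of $L^2(\mathbb{R}^d)$, with $\langle f,g\rangle=\int_{\mathbb{R}^d}\overline{f}\,g\,dx$. The correlation system is the system satisfied by the correlations $z_{jk}=\langle\psi_j,\psi_k\rangle$ of solutions $\psi_1,\dots,\psi_N$, $\|\psi_j\|_2=1$, of the Schrödinger-Lohe model. Notation: $\lambda_\infty=\|\zeta_\infty\|_2\in[0,1]$; $z_{jk}^\infty=\langle\psi_{j,\infty},\psi_{k,\infty}\rangle$, $r_{jk}^\infty=\mathrm{Re}\,z_{jk}^\infty$, $s_{jk}^\infty=\mathrm{Im}\,z_{jk}^\infty$; $z_j^\infty=\langle\zeta_\infty,\psi_{j,\infty}\rangle$, $r_j^\infty=\mathrm{Re}\,z_j^\infty$, $s_j^\infty=\mathrm{Im}\,z_j^\infty$. The angle $\alpha_j$ denotes how far $\psi_{j,\infty}$ is rotated away from the order parameter $\zeta_\infty$.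
   Formalization: It is assumed that λ_∞ ≠ 0, since the formula for ψ_{j,∞} divides by λ_∞ and the claim fails when ζ_∞ = 0; the angles α_j satisfy λ_∞ sin α_j = Ω_j/κ and are unique for the given ψ_{j,∞}, not functions of κ, Ω_j alone. *)

(* Defs.v *)
From HB Require Import structures.
From mathcomp Require Import all_boot all_order all_algebra.
From mathcomp Require Import all_classical all_reals all_analysis.
From mathcomp Require Import complex.

Set Implicit Arguments.
Unset Strict Implicit.
Unset Printing Implicit Defensive.

Import Order.TTheory GRing.Theory Num.Theory.
Import numFieldNormedType.Exports.

Local Open Scope classical_set_scope.
Local Open Scope ring_scope.
Local Open Scope complex_scope.

(* R^d with the product Borel sigma-algebra *)
Notation Rd R d := (d.-tuple (measurableTypeR R)).

Section lebesgue_Rd.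
Variable R : realType.

Definition consRd d (x : measurableTypeR R * Rd R d) : Rd R d.+1 :=
  [tuple of x.1 :: x.2].

Definition unconsRd d (t : Rd R d.+1) : measurableTypeR R * Rd R d :=
  (thead t, [tuple of behead t]).

Lemma unconsRdK d : cancel (@unconsRd d) (@consRd d).
Proof. by move=> t; rewrite /consRd /unconsRd [RHS]tuple_eta; apply: val_inj. Qed.

Lemma consRdK d : cancel (@consRd d) (@unconsRd d).
Proof. by move=> [x t]; congr pair; apply: val_inj. Qed.

Lemma measurable_consRd d : measurable_fun setT (@consRd d).
Proof. exact: measurable_cons. Qed.

Lemma measurable_unconsRd d : measurable_fun setT (@unconsRd d).
Proof.
apply: measurable_fun_pair; first exact: measurable_tnth.
exact: measurable_behead.
Qed.

HB.instance Definition _ d :=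
  isMeasurableFun.Build _ _ _ _ (@consRd d) (@measurable_consRd d).

Section succ.
Variables (d : nat) (mu : {sigma_finite_measure set (Rd R d) -> \bar R}).

Definition lebesgue_cons : set (Rd R d.+1) -> \bar R :=
  pushforward (@lebesgue_measure R \x mu)%E (@consRd d).

Let lebesgue_cons0 : lebesgue_cons set0 = 0%E.
Proof. exact: measure0. Qed.

Let lebesgue_cons_ge0 A : (0 <= lebesgue_cons A)%E.
Proof. exact: measure_ge0. Qed.

Let lebesgue_cons_sigma_additive : semi_sigma_additive lebesgue_cons.
Proof. exact: measure_semi_sigma_additive. Qed.

HB.instance Definition _ := isMeasure.Build _ _ _ lebesgue_cons
  lebesgue_cons0 lebesgue_cons_ge0 lebesgue_cons_sigma_additive.

Let lebesgue_cons_sigma_finite : sigma_finite setT lebesgue_cons.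
Proof.
have /sigma_finiteP[F [FT ndF Foo]] := sigma_finiteT (@lebesgue_measure R).
have /sigma_finiteP[G [GT ndG Goo]] := sigma_finiteT mu.
exists (fun n => @unconsRd d @^-1` (F n `*` G n)).
  rewrite -preimage_bigcup (_ : \bigcup_n _ = setT) ?preimage_setT//.
  rewrite -subTset => -[x y] _.
  have [n _ Fnx] : (\bigcup_n F n) x by rewrite -FT.
  have [k _ Gky] : (\bigcup_n G n) y by rewrite -GT.
  exists (maxn n k) => //; split.
    by move: x Fnx; exact/subsetPset/ndF/leq_maxl.
  by move: y Gky; exact/subsetPset/ndG/leq_maxr.
move=> n; have [mF Fn] := Foo n; have [mG Gn] := Goo n; split.
  rewrite -[X in measurable X]setTI.
  by apply: measurable_unconsRd => //; exact: measurableX.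
rewrite /lebesgue_cons /pushforward -comp_preimage.
rewrite (_ : _ \o _ = id); last by apply/funext => x /=; rewrite consRdK.
by rewrite preimage_id product_measure1E// lte_mul_pinfty// ge0_fin_numE.
Qed.

HB.instance Definition _ := @Measure_isSigmaFinite.Build _ _ _
  lebesgue_cons lebesgue_cons_sigma_finite.

End succ.

(* the d-dimensional Lebesgue measure; see lebesgue_Rd_box *)
Fixpoint lebesgue_Rd d : {sigma_finite_measure set (Rd R d) -> \bar R} :=
  match d with
  | 0 => dirac [tuple]
  | d'.+1 => lebesgue_cons (lebesgue_Rd d')
  end.

Lemma lebesgue_Rd_box d (A : 'I_d -> set (measurableTypeR R)) :
  (forall i, measurable (A i)) ->
  lebesgue_Rd d [set t | forall i, A i (tnth t i)]
  = (\prod_(i < d) @lebesgue_measure R (A i))%E.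
Proof.
elim: d A => [|d IH] A mA /=.
  by rewrite big_ord0 diracE mem_set// => -[].
rewrite big_ord_recl -IH//.
pose B := [set t : Rd R d | forall i, A (lift ord0 i) (tnth t i)].
have mB : measurable B.
  rewrite (_ : B = \bigcap_(i in [set: 'I_d])
      (fun t : Rd R d => tnth t i) @^-1` A (lift ord0 i)).
    apply: fin_bigcap_measurable => // i _.
    by rewrite -[X in measurable X]setTI; exact: measurable_tnth.
  by apply/seteqP; split=> t Bt i; [move=> _; exact: Bt|exact: (Bt i I)].
rewrite -[RHS]product_measure1E//; congr (product_measure1 _ _ _).
apply/seteqP; split=> -[x t] /=.
  move=> At; split; first by have := At ord0; rewrite tnth0.
  by move=> i; have := At (lift ord0 i); rewrite tnthS.
move=> [Ax Bt] i; have [j ->|->] := unliftP ord0 i.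
  by rewrite tnthS; exact: Bt.
by rewrite tnth0.
Qed.

End lebesgue_Rd.

Section L2.
Variables (R : realType) (d : nat).
Local Notation mu := (lebesgue_Rd R d).
Implicit Types f g : Rd R d -> R[i].

(* Elements of L^2(R^d; C) are represented by functions; equality in L^2 is
   equality almost everywhere. *)
Definition inL2 f : Prop :=
  ((fun x => complex.Re (f x)) \in Lfun mu 2%:E) /\
  ((fun x => complex.Im (f x)) \in Lfun mu 2%:E).

Definition Cintegral f : R[i] :=
  (\int[mu]_x complex.Re (f x)) +i* (\int[mu]_x complex.Im (f x)).

(* conjugate-linear in the first argument *)
Definition inner f g : R[i] := Cintegral (fun x => (f x)^*%C * g x).

Definition norm2 f : R := Num.sqrt (\int[mu]_x (Normc.normc (f x) ^+ 2)).

End L2.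

Definition expi (R : realType) (t : R) : R[i] := cos t +i* sin t.

Section SchroedingerLohe.
Variables (R : realType) (d N : nat) (kappa : R) (Omega : 'I_N -> R).
Local Notation mu := (lebesgue_Rd R d).
Implicit Types psi : 'I_N -> Rd R d -> R[i].

Definition order_parameter psi : Rd R d -> R[i] :=
  fun x => (N%:R)^-1 * \sum_(l < N) psi l x.

Definition order_amplitude psi : R := norm2 (order_parameter psi).

Definition correlation psi (j k : 'I_N) : R[i] := inner (psi j) (psi k).

Definition order_correlation psi (j : 'I_N) : R[i] :=
  inner (order_parameter psi) (psi j).

Definition stationary psi : Prop := forall j,
  {ae mu, forall x,
    0 = (Omega j)%:C * psi j x
        + 'i%C * (kappa / 2)%:C
          * (order_parameter psi x - order_correlation psi j * psi j x)}.

Definition correlation_field (z : 'I_N -> 'I_N -> R[i]) (j k : 'I_N) : R[i] :=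
  'i%C * (Omega j - Omega k)%:C * z j k
  + (kappa / (2 * N%:R))%:C * \sum_(l < N) (z j l + z l k) * (1 - z j k).

Definition correlation_fixed_point (z : 'I_N -> 'I_N -> R[i]) : Prop :=
  forall j k, correlation_field z j k = 0.

Record phase_relations psi (alpha : 'I_N -> R) : Prop := PhaseRelations {
  phase_range : forall j, - pi <= alpha j < pi;
  phase_state : forall j, {ae mu, forall x,
    psi j x = order_parameter psi x / (order_amplitude psi)%:C
              * expi (- alpha j)};
  phase_rjk : forall j k,
    complex.Re (correlation psi j k) = cos (alpha j - alpha k);
  phase_sjk : forall j k,
    complex.Im (correlation psi j k) = sin (alpha j - alpha k);
  phase_zjk : forall j k,
    correlation psi j k = expi (alpha j - alpha k);
  phase_rj : forall j,
    complex.Re (order_correlation psi j) = order_amplitude psi * cos (alpha j);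
  phase_sj : forall j,
    complex.Im (order_correlation psi j) = - (order_amplitude psi * sin (alpha j));
  phase_Omega : forall j,
    - (order_amplitude psi * sin (alpha j)) = - (Omega j / kappa);
  phase_zj : forall j,
    order_correlation psi j = (order_amplitude psi)%:C * expi (- alpha j);
  phase_lambda :
    order_amplitude psi = N%:R^-1 * \sum_(j < N) cos (alpha j);
  phase_sin : 0 = N%:R^-1 * \sum_(j < N) sin (alpha j)
}.

End SchroedingerLohe.

(* Main.v *)
(* A stationary state satisfies zeta = c_j psi_j almost everywhere, with
   c_j = w_j + 2 i Omega_j / kappa and w_j = <zeta, psi_j>. Pairing with the
   unit vector psi_j gives w_j = conj(c_j) and |c_j| = lambda, so
   c_j = lambda e^{i alpha_j} and Omega_j / kappa = Im c_j = lambda sin alpha_j.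
   Averaging psi_j = (zeta / lambda) e^{-i alpha_j} over j shows that the mean
   of e^{-i alpha_j} is lambda. Conversely, the phase relations say
   i Omega_j = (kappa lambda / 2) (e^{i alpha_j} - e^{-i alpha_j}), which turns
   the stationary equations and the vanishing of the correlation field into
   polynomial identities in e^{i alpha_j} and e^{-i alpha_j}. *)
Require Import Defs.
From mathcomp Require Import all_boot all_order all_algebra.
From mathcomp Require Import all_classical all_reals all_analysis.
From mathcomp Require Import measurable_realfun complex.
From mathcomp Require Import ring lra.

Set Implicit Arguments.
Unset Strict Implicit.
Unset Printing Implicit Defensive.

Import Order.TTheory GRing.Theory Num.Theory.
Local Open Scope ring_scope.

(** * Complex exponentials of real angles *)

Section expi.
Variable R : realType.
Implicit Types (a b : R) (z : R[i]).
Local Open Scope complex_scope.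

Lemma expiD a b : expi (a + b) = expi a * expi b.
Proof.
rewrite /expi cosD sinD; simpc.
by congr (_ +i* _); ring.
Qed.

Lemma expi0 : expi (0 : R) = 1.
Proof. by rewrite /expi cos0 sin0. Qed.

(** [ring] and [field] see [expi a] and [expi (- a)] as unrelated symbols; this is the relation fed
    to them. *)
Lemma expiNM a : expi (- a) * expi a = 1.
Proof. by rewrite -expiD addNr expi0. Qed.

Lemma conjc_expi a : (expi a)^*%C = expi (- a).
Proof. by rewrite /expi cosN sinN. Qed.

Lemma expi_neq0 a : expi a != 0.
Proof.
apply/eqP => a0; have /eqP := expiNM a.
by rewrite a0 mulr0 eq_sym oner_eq0.
Qed.

Lemma expi_sin a : 2 * 'i%C * (sin a)%:C = expi a - expi (- a).
Proof.
rewrite /expi cosN sinN; apply/eqP; rewrite eq_complex /=.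
by apply/andP; split; apply/eqP; ring.
Qed.

(** Equal exponentials give cos (a - b) = 1, so the sine of the half-difference t vanishes. The
    range forces |t| < pi, where the only zero of the sine is t = 0. *)
Lemma expi_inj a b :
  - pi <= a < pi -> - pi <= b < pi -> expi a = expi b -> a = b.
Proof.
move=> ab bb [cab sab].
set t := (a - b) / 2.
have : cos (t *+ 2) = 1.
  rewrite (_ : t *+ 2 = a - b); last by rewrite /t; field.
  by rewrite cosB cab sab -!expr2 cos2sin2 subrK.
rewrite cos_mulr2n cos2sin2 => sint.
have {sint} /eqP : sin t ^+ 2 = 0 by lra.
rewrite sqrf_eq0 => /eqP st.
have tpi : `|t| < pi by rewrite ltr_norml /t; apply/andP; split; lra.
have [t0|t0] := eqVneq t 0; first by move: t0; rewrite /t; lra.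
have := @sin_gt0_pi R `|t|.
rewrite normr_gt0 t0 tpi => /(_ isT).
have [t1|t1] := leP 0 t; first by rewrite ger0_norm// st ltxx.
by rewrite ltr0_norm// sinN st oppr0 ltxx.
Qed.

Lemma expi_surj z : Normc.normc z = 1 ->
  exists2 a, - pi <= a < pi & expi a = z.
Proof.
case: z => x y /= /(congr1 (fun u => u ^+ 2)).
rewrite sqr_sqrtr ?expr1n; last by rewrite addr_ge0 ?sqr_ge0.
move=> xy1.
have xb : -1 <= x <= 1 by apply/andP; split; nra.
have cx : cos (acos x) = x by apply: acosK; rewrite in_itv.
have sx : sin (acos x) = `|y|.
  by rewrite sin_acos// (_ : 1 - x ^+ 2 = y ^+ 2) ?sqrtr_sqr//; lra.
have p0 := @pi_gt0 R.
have a0 := acos_ge0 xb; have a1 := acos_lepi xb.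
(* The case y = 0 joins the negative branch: for z = -1 it yields the angle -pi, which is in range,
   whereas pi is not. *)
have [y0|y0] := ltP 0 y; last first.
  exists (- acos x); first by apply/andP; split; lra.
  by rewrite /expi cosN sinN cx sx ler0_norm// opprK.
have x1 : -1 < x by nra.
have := @acos_ltpi R x.
rewrite x1; case/andP: xb => _ -> /(_ isT) a2.
exists (acos x); first by apply/andP; split; lra.
by rewrite /expi cx sx gtr0_norm.
Qed.

Lemma sum_complex n (x y : 'I_n -> R) :
  \sum_(j < n) (x j +i* y j) = (\sum_(j < n) x j) +i* (\sum_(j < n) y j).
Proof. by elim/big_ind3: _ => // ? ? ? ? ? ? -> ->. Qed.

End expi.

(** * Inner products of constant multiples of a unit vector *)

Section L2_multiples.
Variables (R : realType) (d : nat).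
Local Notation mu := (lebesgue_Rd R d).
Implicit Types (f g h : Rd R d -> R[i]) (a b : R[i]).
Local Open Scope classical_set_scope.
Local Open Scope complex_scope.

(** Weaker than [inL2] and stable under products, so it passes to the order parameter and to the
    integrands of [inner]. *)
Definition cmeasurable f :=
  measurable_fun [set: Rd R d] (fun x => complex.Re (f x)) /\
  measurable_fun [set: Rd R d] (fun x => complex.Im (f x)).

Lemma inL2_cmeasurable f : inL2 f -> cmeasurable f.
Proof.
by move=> [/sub_Lfun_mfun/set_mem mr /sub_Lfun_mfun/set_mem mi].
Qed.

Lemma cmeasurable_cst a : cmeasurable (fun=> a).
Proof. by split; exact: measurable_cst. Qed.

Lemma cmeasurableD f g :
  cmeasurable f -> cmeasurable g -> cmeasurable (fun x => f x + g x).
Proof.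
move=> [fr fi] [gr gi]; split.
- rewrite (_ : (fun x => _) = (fun x => complex.Re (f x) + complex.Re (g x))).
    exact: measurable_funD.
  by apply/funext => x; case: (f x) => ? ?; case: (g x).
- rewrite (_ : (fun x => _) = (fun x => complex.Im (f x) + complex.Im (g x))).
    exact: measurable_funD.
  by apply/funext => x; case: (f x) => ? ?; case: (g x).
Qed.

Lemma cmeasurableM f g :
  cmeasurable f -> cmeasurable g -> cmeasurable (fun x => f x * g x).
Proof.
move=> [fr fi] [gr gi]; split.
- rewrite (_ : (fun x => _) = (fun x => complex.Re (f x) * complex.Re (g x)
      - complex.Im (f x) * complex.Im (g x))).
    by apply: measurable_funB; exact: measurable_funM.
  by apply/funext => x; case: (f x) => ? ?; case: (g x).
- rewrite (_ : (fun x => _) = (fun x => complex.Re (f x) * complex.Im (g x)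
      + complex.Im (f x) * complex.Re (g x))).
    by apply: measurable_funD; exact: measurable_funM.
  by apply/funext => x; case: (f x) => ? ?; case: (g x).
Qed.

Lemma cmeasurable_conj f : cmeasurable f -> cmeasurable (fun x => (f x)^*%C).
Proof.
move=> [fr fi]; split.
- by rewrite (_ : (fun x => _) = (fun x => complex.Re (f x)))//;
    apply/funext => x; case: (f x).
- rewrite (_ : (fun x => _) = \- (fun x => complex.Im (f x))).
    exact: measurableT_comp.
  by apply/funext => x /=; case: (f x).
Qed.

Lemma cmeasurable_order_parameter N (psi : 'I_N -> Rd R d -> R[i]) :
  (forall j, cmeasurable (psi j)) -> cmeasurable (order_parameter psi).
Proof.
move=> mpsi; apply: cmeasurableM; first exact: cmeasurable_cst.
elim: (index_enum _) => [|j r IH].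
  under eq_fun do rewrite big_nil; exact: cmeasurable_cst.
under eq_fun do rewrite big_cons; exact: cmeasurableD.
Qed.

Lemma normc_sqr a : Normc.normc a ^+ 2 = complex.Re (a^*%C * a).
Proof.
case: a => x y /=; rewrite sqr_sqrtr ?addr_ge0 ?sqr_ge0//; ring.
Qed.

Lemma conjcM_real a : a^*%C * a = (Normc.normc a ^+ 2)%:C.
Proof.
rewrite normc_sqr; case: a => x y; apply/eqP; rewrite eq_complex /=.
by apply/andP; split; apply/eqP; ring.
Qed.

Lemma norm2_inner f : norm2 f = Num.sqrt (complex.Re (inner f f)).
Proof.
rewrite /norm2 /inner /Cintegral /=; congr (Num.sqrt (Rintegral _ _ _)).
by apply/funext => x; rewrite normc_sqr.
Qed.

Lemma integrable_normc_sqr f : cmeasurable f -> norm2 f = 1 ->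
  mu.-integrable setT (EFin \o (fun x => Normc.normc (f x) ^+ 2)) /\
  \int[mu]_x (Normc.normc (f x) ^+ 2) = 1.
Proof.
move=> mf; rewrite /norm2 => f1.
have I1 : \int[mu]_x (Normc.normc (f x) ^+ 2) = 1.
  have I0 : 0 <= \int[mu]_x (Normc.normc (f x) ^+ 2).
    by apply: Rintegral_ge0 => x _; exact: sqr_ge0.
  by rewrite -(sqr_sqrtr I0) f1 expr1n.
split=> //; apply/integrableP; split.
  apply/measurable_EFinP.
  under eq_fun do rewrite normc_sqr.
  exact: (cmeasurableM (cmeasurable_conj mf) mf).1.
under eq_integral do rewrite /= ger0_norm ?sqr_ge0//.
(* [fine] sends infinity to 0, so the value 1 forces the integral to be finite. *)
move: I1; rewrite /Rintegral.
case: (integral _ _ _) => [r||] /=; rewrite ?ltry// => /eqP;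
  by rewrite eq_sym oner_eq0.
Qed.

(* Both arguments are constant multiples of a unit vector, so sesquilinearity
   reduces to pulling a constant out of the integral of [|f|^2]. *)
Lemma inner_scale f g h a b :
  cmeasurable f -> norm2 f = 1 -> cmeasurable g -> cmeasurable h ->
  {ae mu, forall x, g x = a * f x} -> {ae mu, forall x, h x = b * f x} ->
  inner g h = a^*%C * b.
Proof.
move=> mf f1 mg mh ga hb.
have [If I1] := integrable_normc_sqr mf f1.
have [mfr _] := cmeasurableM (cmeasurable_conj mf) mf.
have [mr mi] := cmeasurableM (cmeasurable_conj mg) mh.
have mn c : measurable_fun [set: Rd R d]
    (EFin \o (fun x => c * Normc.normc (f x) ^+ 2)).
  apply/measurable_EFinP; apply: measurable_funM => //.
  by under eq_fun do rewrite normc_sqr.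
have gh : {ae mu, forall x, (g x)^*%C * h x
    = a^*%C * b * (Normc.normc (f x) ^+ 2)%:C}.
  apply: filterS2 ga hb => x -> ->; rewrite -conjcM_real rmorphM; ring.
rewrite /inner /Cintegral [RHS](_ : _ = complex.Re (a^*%C * b) +i*
  complex.Im (a^*%C * b)); last by case: (_ * _).
congr (_ +i* _).
- transitivity (\int[mu]_x
    (complex.Re (a^*%C * b) * Normc.normc (f x) ^+ 2)); last first.
    by rewrite RintegralZl// I1 mulr1.
  congr fine; apply: ae_eq_integral => //; [exact/measurable_EFinP|exact: mn|].
  apply: filterS gh => x ghx _; rewrite /= ghx; congr EFin.
  by case: (_ * b) => u v /=; rewrite mulr0 subr0.
- transitivity (\int[mu]_x
    (complex.Im (a^*%C * b) * Normc.normc (f x) ^+ 2)); last first.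
    by rewrite RintegralZl// I1 mulr1.
  congr fine; apply: ae_eq_integral => //; [exact/measurable_EFinP|exact: mn|].
  apply: filterS gh => x ghx _; rewrite /= ghx; congr EFin.
  by case: (_ * b) => u v /=; rewrite mulr0 add0r.
Qed.

End L2_multiples.

(** * Consequences of the phase relations *)

Section phases.
Variables (R : realType) (d N : nat) (kappa : R) (Omega : 'I_N -> R).
Variable psi : 'I_N -> Rd R d -> R[i].
Local Notation mu := (lebesgue_Rd R d).
Local Notation zeta := (order_parameter psi).
Local Notation lambda := (order_amplitude psi).
Local Notation w := (order_correlation psi).
Local Open Scope complex_scope.

Hypotheses (N_gt0 : (0 < N)%N) (kappa_gt0 : 0 < kappa).
Hypotheses (psiL2 : forall j, inL2 (psi j)) (psi1 : forall j, norm2 (psi j) = 1).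
Hypothesis lambda_neq0 : lambda != 0.

Let lambdaC_neq0 : lambda%:C != 0.
Proof. by rewrite fmorph_eq0. Qed.

Let psi_cmeas j : cmeasurable (psi j).
Proof. exact: inL2_cmeasurable. Qed.

Let zeta_cmeas : cmeasurable zeta.
Proof. exact: cmeasurable_order_parameter. Qed.

Section phase_relations.
Variable alpha : 'I_N -> R.
Hypothesis P : phase_relations kappa Omega psi alpha.

(** [phase_lambda] and [phase_sin] are the real and imaginary parts of this identity, the form in
    which they enter the correlation field. *)
Lemma phase_sum_expi : \sum_(l < N) expi (alpha l) = N%:R * lambda%:C.
Proof.
have N0 : N%:R != 0 :> R by rewrite pnatr_eq0 -lt0n.
rewrite sum_complex.
have -> : \sum_(j < N) cos (alpha j) = N%:R * lambda.
  by rewrite (phase_lambda P) mulVKf.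
have -> : \sum_(j < N) sin (alpha j) = 0.
  have /esym/eqP := phase_sin P.
  by rewrite mulf_eq0 invr_eq0 (negPf N0) => /eqP.
by rewrite -[LHS]/((N%:R * lambda)%:C) rmorphM rmorph_nat.
Qed.

Lemma phase_sum_expiN : \sum_(l < N) expi (- alpha l) = N%:R * lambda%:C.
Proof.
under eq_bigr do rewrite -conjc_expi.
rewrite -rmorph_sum phase_sum_expi rmorphM rmorph_nat.
by congr (_ * _); exact: conjc_real.
Qed.

(** Euler's formula for the sine, applied to [phase_Omega]. It eliminates the frequencies from the
    stationary equations and the correlation field. *)
Lemma phase_iOmega j : 'i%C * (Omega j)%:C
  = (kappa / 2)%:C * (lambda%:C * (expi (alpha j) - expi (- alpha j))).
Proof.
have k0 : kappa != 0 by rewrite gt_eqF.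
have /oppr_inj e := phase_Omega P j.
have -> : Omega j = kappa * (lambda * sin (alpha j)).
  by rewrite e mulrC divfK.
by rewrite -expi_sin !rmorphM /= fmorphV rmorph_nat; field.
Qed.

Lemma phase_stationary : stationary kappa Omega psi.
Proof.
move=> j; apply: filterS (phase_state P j) => x e.
have -> : zeta x = lambda%:C * expi (alpha j) * psi j x.
  rewrite e -[LHS]mul1r -(expiNM (alpha j)); field; exact: lambdaC_neq0.
rewrite (phase_zj P).
(* Zero is written as Omega + i (i Omega) so that [phase_iOmega] can replace the inner product by
   exponentials. *)
transitivity (((Omega j)%:C + 'i%C * ('i%C * (Omega j)%:C)) * psi j x).
  by rewrite mulrA -expr2 sqr_i; ring.
by rewrite phase_iOmega; ring.
Qed.

Lemma phase_fixed_point : correlation_fixed_point kappa Omega (correlation psi).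
Proof.
have N0 : N%:R != 0 :> R[i] by rewrite pnatr_eq0 -lt0n.
move=> j k; rewrite /correlation_field !(phase_zjk P).
under eq_bigr do rewrite !(phase_zjk P) !expiD.
rewrite -mulr_suml big_split /= -mulr_sumr -mulr_suml.
rewrite phase_sum_expi phase_sum_expiN rmorphB mulrBr !phase_iOmega expiD.
rewrite !rmorphM !fmorphV rmorphM !rmorph_nat /=.
have Ej := expiNM (alpha j); have Ek := expiNM (alpha k).
set E := expi (alpha j) in Ej *; set E' := expi (- alpha j) in Ej *.
set F := expi (alpha k) in Ek *; set F' := expi (- alpha k) in Ek *.
(* The cubic terms E^2 F' and E F'^2 cancel between the rotation and the coupling; the remainder
   vanishes by E' E = F' F = 1. *)
transitivity (kappa%:C * lambda%:C / 2 *
  (F' * (1 - E' * E) + E * (1 - F' * F))).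
  by field.
by rewrite Ej Ek !subrr !mulr0 addr0 mulr0.
Qed.

(** Since lambda is nonzero, [phase_zj] fixes exp(-i alpha_j), and [phase_range] leaves a single
    angle. *)
Lemma phase_unique beta : phase_relations kappa Omega psi beta -> alpha = beta.
Proof.
move=> Q; apply/funext => j; apply: expi_inj.
- exact: phase_range P j.
- exact: phase_range Q j.
apply: (can_inj (@conjcK R)); rewrite !conjc_expi.
by apply: (mulfI lambdaC_neq0); rewrite -(phase_zj P) -(phase_zj Q).
Qed.

End phase_relations.

(** * Phases of a stationary state *)

Lemma stationary_phase : stationary kappa Omega psi ->
  exists alpha, phase_relations kappa Omega psi alpha.
Proof.
move=> st.
have kC0 : kappa%:C != 0 by rewrite fmorph_eq0 gt_eqF.
pose c j := w j + 2 * 'i%C * (Omega j / kappa)%:C.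
have zc j : {ae mu, forall x, zeta x = c j * psi j x}.
  apply: filterS (st j) => x /esym e; apply/eqP; rewrite -subr_eq0.
  (* This is -2i / kappa times the stationary equation. As [field] does not know i^2 = -1, a
     vanishing multiple of 1 + i^2 is added to compensate. *)
  apply/eqP; transitivity ((1 + 'i%C ^+ 2) * (zeta x - w j * psi j x)
      + - 2 * 'i%C / kappa%:C * 0); last by rewrite sqr_i subrr mul0r mulr0 addr0.
  by rewrite -e /c !rmorphM !fmorphV rmorph_nat /=; field.
have psi_refl j : {ae mu, forall x, psi j x = 1 * psi j x}.
  by apply: aeW => x; rewrite mul1r.
have wc j : w j = (c j)^*%C.
  by rewrite /order_correlation (inner_scale (psi_cmeas j) (psi1 j)
    zeta_cmeas (psi_cmeas j) (zc j) (psi_refl j)) mulr1.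
have lc j : lambda = Normc.normc (c j).
  rewrite /order_amplitude norm2_inner (inner_scale (psi_cmeas j) (psi1 j)
    zeta_cmeas zeta_cmeas (zc j) (zc j)) -normc_sqr sqrtr_sqr ger0_norm//.
  by case: (c j) => x y; exact: sqrtr_ge0.
have /choice[alpha alphaP] : forall j, exists a,
    - pi <= a < pi /\ c j = lambda%:C * expi a.
  move=> j; have [|a ab ea] := @expi_surj R (c j / lambda%:C).
    have lambda_ge0 : 0 <= lambda := sqrtr_ge0 _.
    rewrite Normc.normcM Normc.normcV -lc /= expr0n addr0 sqrtr_sqr.
    by rewrite ger0_norm// divff.
  by exists a; rewrite ea mulrC divfK.
have alpha_range j := (alphaP j).1; have cE j := (alphaP j).2.
have wE j : w j = lambda%:C * expi (- alpha j).
  by rewrite wc cE rmorphM [X in X * _]conjc_real [X in _ * X]conjc_expi.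
have psiE j : {ae mu, forall x,
    psi j x = zeta x / lambda%:C * expi (- alpha j)}.
  apply: filterS (zc j) => x ->; rewrite cE.
  rewrite -[LHS]mul1r -(expiNM (alpha j)); field; exact: lambdaC_neq0.
(* Eliminating zeta gives psi_k = e^{i (alpha_j - alpha_k)} psi_j, so both arguments are multiples
   of [psi j]. *)
have corrE j k : correlation psi j k = expi (alpha j - alpha k).
  rewrite -[RHS]mul1r -[X in X * _]conjc1.
  apply: (inner_scale (psi_cmeas j)) => //.
  apply: filterS2 (zc j) (psiE k) => x zx ->.
  by rewrite zx cE expiD; field; exact: lambdaC_neq0.
(* Averaging [psiE] gives zeta = (m / lambda) zeta almost everywhere. Pairing with one [psi j] turns
   this into the scalar equation c_j = (m / lambda) c_j, where c_j is nonzero. *)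
have mean : N%:R^-1 * \sum_(l < N) expi (- alpha l) = lambda%:C.
  pose m := N%:R^-1 * \sum_(l < N) expi (- alpha l).
  pose j := Ordinal N_gt0.
  have c0 : c j != 0 by rewrite cE mulf_neq0// expi_neq0.
  have zm : {ae mu, forall x, zeta x = m / lambda%:C * c j * psi j x}.
    have psiA : {ae mu, forall x, forall l,
        psi l x = zeta x / lambda%:C * expi (- alpha l)}.
      exact: filter_forall psiE.
    apply: filterS2 psiA (zc j) => x px zx.
    rewrite /order_parameter -(mulrA _ (c j)) -zx /m.
    rewrite (eq_bigr _ (fun l _ => px l)) -mulr_sumr.
    by field; rewrite lambdaC_neq0 pnatr_eq0 -lt0n N_gt0.
  have := inner_scale (psi_cmeas j) (psi1 j) (psi_cmeas j) zeta_cmeas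
    (psi_refl j) zm.
  rewrite (inner_scale (psi_cmeas j) (psi1 j) (psi_cmeas j) zeta_cmeas
    (psi_refl j) (zc j)) conjc1 !mul1r -[LHS]mul1r => /(mulIf c0)/esym.
  by move=> /(canRL (divfK lambdaC_neq0)); rewrite mul1r.
have [mean_cos mean_sin] : N%:R^-1 * \sum_(j < N) cos (alpha j) = lambda
    /\ N%:R^-1 * \sum_(j < N) sin (alpha j) = 0.
  move: mean; rewrite sum_complex -(rmorph_nat (real_complex R)) -fmorphV.
  under eq_bigr do rewrite cosN.
  under [X in _ +i* X]eq_bigr do rewrite sinN.
  rewrite sumrN => -[] /=; rewrite !mul0r subr0 addr0 mulrN => -> /eqP.
  by rewrite oppr_eq0 => /eqP.
(* Imaginary part of c_j - 2 i Omega_j / kappa = conj(c_j). *)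
have sinE j : lambda * sin (alpha j) = Omega j / kappa.
  have := wc j; rewrite -[w j](addrK (2 * 'i%C * (Omega j / kappa)%:C)) -/(c j).
  rewrite cE => /(congr1 (@complex.Im R)) /=; lra.
exists alpha; split => //.
- by move=> j k; rewrite corrE.
- by move=> j k; rewrite corrE.
- by move=> j; rewrite wE /= cosN mul0r subr0.
- by move=> j; rewrite wE /= sinN mul0r addr0 mulrN.
- by move=> j; rewrite sinE.
Qed.

End phases.

(** [exists!] renders that the angles are determined, and the nonzero amplitude gives zeta / lambda
    its meaning. *)
Theorem lemma3p3 (R : realType) (d N : nat) (kappa : R) (Omega : 'I_N -> R)
    (psi : 'I_N -> Rd R d -> R[i]) :
  (0 < N)%N -> 0 < kappa ->
  N%:R^-1 * \sum_(j < N) Omega j = 0 ->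
  (forall j, inL2 (psi j)) -> (forall j, norm2 (psi j) = 1) ->
  order_amplitude psi != 0 ->
  (stationary kappa Omega psi <->
    exists! alpha : 'I_N -> R, phase_relations kappa Omega psi alpha) /\
  (forall alpha : 'I_N -> R, phase_relations kappa Omega psi alpha ->
    correlation_fixed_point kappa Omega (correlation psi)).
Proof.
move=> N0 k0 _ psiL2 psi1 l0; split; last first.
  by move=> alpha P; exact: (phase_fixed_point N0 k0 P).
split=> [/(stationary_phase N0 k0 psiL2 psi1 l0)[alpha P]|[alpha [P _]]].
  by exists alpha; split=> // beta Q; exact: (phase_unique l0 P Q).
exact: (phase_stationary k0 l0 P).
Qed.
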